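(* Let $Z$ be a complex matrix or a complex linear operator on the complexification of a real discrete (finite-dimensional) space, and define its realification by $$\mathfrak R(Z):=\begin{bmatrix}\operatorname{Re}Z&-\operatorname{Im}Z\\ \operatorname{Im}Z&\operatorname{Re}Z\end{bmatrix}.$$ For $U=X+\mathrm iY$ with $X,Y$ real, identify $U$ with the doubled real vector $(X^{\mathsf T},Y^{\mathsf T})^{\mathsf T}$. Then $$\mathfrak R(Z)\begin{bmatrix}X\\ Y\end{bmatrix}=\begin{bmatrix}\operatorname{Re}(ZU)\\ \operatorname{Im}(ZU)\end{bmatrix},\qquad \mathfrak R(Z_1Z_2)=\mathfrak R(Z_1)\mathfrak R(Z_2)$$ for all such $Z,Z_1,Z_2$. Consequently the complex phase-optimized splitting $\Phi_{\rm disp}$, acting on $\mathbb{C}^N$, has an exactly equivalent $2N$-dimensional real representation $$\widehat\Phi_{\rm disp}=\mathfrak R(\Phi_{\rm disp}),\qquad \widehat\Phi_{\rm disp}^{\,n}=\mathfrak R(\Phi_{\rm disp}^{\,n}).$$ If the initial Maxwell vector $U_h^0\in\mathbb{R}^N$ is real, then $$\widehat\Phi_{\rm disp}^{\,n}\begin{bmatrix}U_h^0\\ 0\end{bmatrix}=\begin{bmatrix}\operatorname{Re}(\Phi_{\rm disp}^{\,n}U_h^0)\\ \operatorname{Im}(\Phi_{\rm disp}^{\,n}U_h^0)\end{bmatrix}.$$ Thus the first $N$ real components are exactly the projected physical field $\widehat U_h^n=\operatorname{Re}(\Phi_{\rm disp}^{\,n}U_h^0)$, with no approximation introduced by the real-arithmetic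 reformulation.
   Context: The semidiscrete Maxwell system is a finite-dimensional real linear system $\frac{d}{dt}U_h=(\mathcal C_h+\mathcal D_h)U_h$ on $\mathbb{R}^N$ for $U_h=(\bm h,\bm e)$ (energy-scaled magnetic and electric fields on a staggered grid), where $$\mathcal C_h=\nu\begin{bmatrix}0&0\\ \nabla_h\times&0\end{bmatrix},\qquad \mathcal D_h=\nu\begin{bmatrix}0&-\nabla_h\times\\ 0&0\end{bmatrix},$$ $\nu>0$ is the wave speed and $\nabla_h\times$ denotes the real discrete curls, so $\mathcal C_h$ and $\mathcal D_h$ are real $N\times N$ matrices with $\mathcal C_h^2=\mathcal D_h^2=0$. With time step $\Delta t$, the phase-optimized splitting is $$\Phi_{\rm disp}=e^{a\Delta t\mathcal C_h}e^{\frac12\Delta t\mathcal D_h}e^{(1-2a)\Delta t\mathcal C_h}e^{\frac12\Delta t\mathcal D_h}e^{a\Delta t\mathcal C_h},\qquad a=a_\pm=\tfrac14\pm\tfrac{\mathrm i}{4\sqrt3}$$ (either fixed sign), regarded as a complex $N\times N$ matrix. $\operatorname{Re}$ and $\operatorname{Im}$ of matrices and vectors are entrywise; the projected physical field at step $n$ is the real part of the complex numerical state. *)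

(* Defs.v *)
From HB Require Import structures.
From mathcomp Require Import all_boot all_order all_algebra.
From mathcomp Require Import all_classical all_reals all_analysis.
From mathcomp Require Export complex.

Set Implicit Arguments.
Unset Strict Implicit.
Unset Printing Implicit Defensive.

Import Order.TTheory GRing.Theory Num.Theory.
Import numFieldNormedType.Exports.

Local Open Scope ring_scope.
Local Open Scope complex_scope.
Local Open Scope classical_set_scope.

Section ComplexMatrices.
Variable R : realType.

Definition mxC m n (A : 'M[R]_(m, n)) : 'M[R[i]]_(m, n) :=
  map_mx (fun x : R => x%:C) A.

Definition mxRe m n (Z : 'M[R[i]]_(m, n)) : 'M[R]_(m, n) :=
  map_mx (@complex.Re R) Z.

Definition mxIm m n (Z : 'M[R[i]]_(m, n)) : 'M[R]_(m, n) :=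
  map_mx (@complex.Im R) Z.

Definition realify m n (Z : 'M[R[i]]_(m, n)) : 'M[R]_(m + m, n + n) :=
  block_mx (mxRe Z) (- mxIm Z) (mxIm Z) (mxRe Z).

(* The identification of U = X + iY with the doubled real vector (X, Y). *)
Definition realvec n (U : 'cV[R[i]]_n) : 'cV[R]_(n + n) :=
  col_mx (mxRe U) (mxIm U).

End ComplexMatrices.

(* The complexification of a real space V, realized on V * V: the pair (x, y)
   stands for x + iy, and R[i] acts accordingly. *)
Definition cspace (V : Type) : Type := (V * V)%type.

Section Complexification.
Variables (R : realType) (V : vectType R).

HB.instance Definition _ := GRing.Zmodule.copy (cspace V) (V * V)%type.

Definition cscale (a : R[i]) (u : cspace V) : cspace V :=
  (complex.Re a *: u.1 - complex.Im a *: u.2,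
   complex.Im a *: u.1 + complex.Re a *: u.2).

Lemma cscaleA a b u : cscale a (cscale b u) = cscale (a * b) u.
Proof.
case: a b u => [a a'] [b b'] [x y]; rewrite /cscale /=.
congr pair; rewrite !scalerDr !scalerN !scalerA !scalerDl ?scaleNr.
  by rewrite !opprD addrACA.
by rewrite addrACA [_ + (a * b') *: x]addrC [- _ + _]addrC.
Qed.

Lemma cscale1 u : cscale 1 u = u.
Proof. by case: u => x y; rewrite /cscale /= !scale1r !scale0r subr0 add0r. Qed.

Lemma cscaleDr a u v : cscale a (u + v) = cscale a u + cscale a v.
Proof.
case: u v => [x y] [x' y']; rewrite /cscale /=; congr pair => /=.
  by rewrite !scalerDr opprD addrACA.
by rewrite !scalerDr addrACA.
Qed.

Lemma cscaleDl u a b : cscale (a + b) u = cscale a u + cscale b u.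
Proof.
case: u a b => [x y] [a a'] [b b']; rewrite /cscale /=; congr pair => /=.
  by rewrite !scalerDl opprD addrACA.
by rewrite !scalerDl addrACA.
Qed.

HB.instance Definition _ := GRing.Zmodule_isLmodule.Build R[i] (cspace V)
  cscaleA cscale1 cscaleDr (fun u a b => cscaleDl u a b).

Definition spC (x : V) : cspace V := (x, 0).
Definition spRe (u : cspace V) : V := u.1.
Definition spIm (u : cspace V) : V := u.2.

End Complexification.

Section Operators.
Variables (R : realType) (V : vectType R).
Implicit Types Z : {linear cspace V -> cspace V}.

(* Z x = opRe Z x + i (opIm Z x) for x in the real space V. *)
Definition opRe Z (x : V) : V := spRe (Z (spC x)).
Definition opIm Z (x : V) : V := spIm (Z (spC x)).

Lemma spC_comb (a : R) (x y : V) : spC (a *: x + y) = a%:C *: spC x + spC y.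
Proof.
by congr pair; rewrite /= ?scale0r ?scaler0 ?subr0 ?addr0.
Qed.

Fact opRe_linear Z : linear (opRe Z).
Proof.
by move=> a x y; rewrite /opRe spC_comb linearP /spRe /= scale0r subr0.
Qed.
HB.instance Definition _ Z :=
  GRing.isLinear.Build R V V _ (opRe Z) (opRe_linear Z).

Fact opIm_linear Z : linear (opIm Z).
Proof.
by move=> a x y; rewrite /opIm spC_comb linearP /spIm /= scale0r add0r.
Qed.
HB.instance Definition _ Z :=
  GRing.isLinear.Build R V V _ (opIm Z) (opIm_linear Z).

(* The block operator [Re Z, - Im Z; Im Z, Re Z] on the doubled real space. *)
Definition oprealify Z (w : V * V) : V * V :=
  (opRe Z w.1 - opIm Z w.2, opIm Z w.1 + opRe Z w.2).

Fact oprealify_linear Z : linear (oprealify Z).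
Proof.
move=> a [x y] [x' y']; rewrite /oprealify /= !linearP.
by congr pair; rewrite /= !scalerDr ?scalerN ?opprD addrACA.
Qed.
HB.instance Definition _ Z :=
  GRing.isLinear.Build R (V * V)%type (V * V)%type _
    (oprealify Z) (oprealify_linear Z).

End Operators.

Definition expmx (K : numFieldType) n (A : 'M[K]_n) : 'M[K]_n :=
  limn (series (fun k : nat => k`!%:R^-1 *: A ^+ k)).

Section Maxwell.
Variable R : realType.
(* nh and ne are the numbers of magnetic and electric unknowns, so N = nh + ne.
   On a staggered grid the curl of the magnetic field and the curl of the
   electric field are different matrices. *)
Variables nh ne : nat.
Variables (nu : R) (curlh : 'M[R]_(ne, nh)) (curle : 'M[R]_(nh, ne)).

Definition Cmat : 'M[R]_(nh + ne) := nu *: block_mx 0 0 curlh 0.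
Definition Dmat : 'M[R]_(nh + ne) := nu *: block_mx 0 (- curle) 0 0.

(* a_+ for s = false and a_- for s = true. *)
Definition acoef (s : bool) : R[i] :=
  4^-1 +i* ((-1) ^+ s / (4 * Num.sqrt 3)).

Definition Phi_disp (dt : R) (s : bool) : 'M[R[i]]_(nh + ne) :=
  let a := acoef s in
  let eC (c : R[i]) := expmx ((c * dt%:C) *: mxC Cmat) in
  let eD (c : R[i]) := expmx ((c * dt%:C) *: mxC Dmat) in
  eC a *m eD 2^-1 *m eC (1 - 2 * a) *m eD 2^-1 *m eC a.

End Maxwell.

Definition projected_field (R : realType) N (Phi : 'M[R[i]]_N) (U0 : 'cV[R]_N)
    (n : nat) : 'cV[R]_N :=
  mxRe (Phi ^+ n *m mxC U0).

(* Main.v *)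
(* Splitting a complex number into its real and imaginary parts identifies the
   left multiplication by Z with a real map, whose block matrix is R(Z); since
   left multiplications compose, R is multiplicative. *)

Require Import Defs.
From HB Require Import structures.
From mathcomp Require Import all_boot all_order all_algebra.
From mathcomp Require Import all_classical all_reals all_analysis.

Set Implicit Arguments.
Unset Strict Implicit.
Unset Printing Implicit Defensive.

Import Order.TTheory GRing.Theory Num.Theory.
Import numFieldNormedType.Exports.

Local Open Scope ring_scope.
Local Open Scope complex_scope.

Section RealImaginaryParts.
Variable R : realType.

(** Taking real parts is additive, so it passes through the sum over the inner index; each summand
    is then the rule for multiplying two complex numbers. *)
Lemma mxRe_mulmx m n p (A : 'M[R[i]]_(m, n)) (B : 'M[R[i]]_(n, p)) :
  mxRe (A *m B) = mxRe A *m mxRe B - mxIm A *m mxIm B.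
Proof.
apply/matrixP => i k; rewrite !mxE raddf_sum -sumrB.
by apply: eq_bigr => j _; rewrite !mxE; case: (A i j) (B j k) => [? ?] [? ?].
Qed.

Lemma mxIm_mulmx m n p (A : 'M[R[i]]_(m, n)) (B : 'M[R[i]]_(n, p)) :
  mxIm (A *m B) = mxIm A *m mxRe B + mxRe A *m mxIm B.
Proof.
apply/matrixP => i k; rewrite !mxE raddf_sum -big_split.
apply: eq_bigr => j _; rewrite !mxE.
by case: (A i j) (B j k) => [? ?] [? ?] /=; rewrite addrC.
Qed.

Lemma mxRe_comb m n (X Y : 'M[R]_(m, n)) : mxRe (mxC X + 'i%C *: mxC Y) = X.
Proof.
by apply/matrixP => i j; rewrite !mxE /= mul0r mul1r subrr addr0.
Qed.

Lemma mxIm_comb m n (X Y : 'M[R]_(m, n)) : mxIm (mxC X + 'i%C *: mxC Y) = Y.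
Proof.
by apply/matrixP => i j; rewrite !mxE /= mul0r mul1r !add0r.
Qed.

Lemma mxC_comb m n (Z : 'M[R[i]]_(m, n)) :
  mxC (mxRe Z) + 'i%C *: mxC (mxIm Z) = Z.
Proof. by apply/matrixP => i j; rewrite !mxE -complexE. Qed.

(** This is what makes the doubled real system equivalent to the complex one: the inverse reads the
    upper half as [X], the lower half as [Y], and forms X + iY. *)
Lemma realvec_bij n : bijective (@realvec R n).
Proof.
exists (fun w => mxC (usubmx w) + 'i%C *: mxC (dsubmx w)) => [U | w].
  by rewrite col_mxKu col_mxKd mxC_comb.
by rewrite /realvec mxRe_comb mxIm_comb vsubmxK.
Qed.

Lemma realvec_mxC n (X : 'cV[R]_n) : realvec (mxC X) = col_mx X 0.
Proof. by congr col_mx; apply/matrixP => i j; rewrite !mxE. Qed.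

(** The two block rows of the product are exactly the formulas for the real and imaginary parts of a
    complex matrix product. *)
Lemma realify_realvec m n (Z : 'M[R[i]]_(m, n)) (U : 'cV[R[i]]_n) :
  realify Z *m realvec U = realvec (Z *m U).
Proof. by rewrite mul_block_col mulNmx -mxRe_mulmx -mxIm_mulmx. Qed.

Lemma realify_mulmx m n p (Z1 : 'M[R[i]]_(m, n)) (Z2 : 'M[R[i]]_(n, p)) :
  realify (Z1 *m Z2) = realify Z1 *m realify Z2.
Proof.
rewrite /realify mulmx_block !mulNmx !mulmxN mxRe_mulmx mxIm_mulmx.
by congr block_mx; rewrite ?opprD addrC.
Qed.

(** Base case that, together with multiplicativity, carries [realify] through powers. *)
Lemma realify1 n : realify (1%:M : 'M[R[i]]_n) = 1%:M.
Proof.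
have Re1 : mxRe (1%:M : 'M[R[i]]_n) = 1%:M.
  by apply/matrixP => i j; rewrite !mxE; case: (i == j).
have Im1 : mxIm (1%:M : 'M[R[i]]_n) = 0.
  by apply/matrixP => i j; rewrite !mxE; case: (i == j).
by rewrite /realify Re1 Im1 oppr0 -scalar_mx_block.
Qed.

Lemma realifyX n (Z : 'M[R[i]]_n) k : realify (Z ^+ k) = realify Z ^+ k.
Proof.
by elim: k => [|k IHk]; [exact: realify1 | rewrite !exprS realify_mulmx IHk].
Qed.

End RealImaginaryParts.

Section OperatorRealification.
Variables (R : realType) (V : vectType R).
Implicit Types Z : {linear cspace V -> cspace V}.

(** Multiplication by i in [cspace V] moves [(Y, 0)] to [(0, Y)]. *)
Lemma spC_decomp (X Y : V) : spC X + 'i%C *: spC Y = (X, Y).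
Proof.
by congr pair; rewrite /= ?scale0r ?scale1r ?scaler0 ?subr0 ?addr0 ?add0r.
Qed.

(* The two sides are convertible types: V * V carries the real structure and
   cspace V the complex one. *)
Lemma oprealifyE Z (w : V * V) : oprealify Z w = Z w.
Proof.
(* Complex linearity determines [Z] by its values on the real vectors [X] and [Y], and the
   components of these values are given by [opRe] and [opIm]. *)
case: w => X Y; rewrite -[in RHS]spC_decomp linearD linearZ /=.
rewrite /oprealify /opRe /opIm /spRe /spIm /=.
case: (Z (spC X)) (Z (spC Y)) => [x y] [x' y'].
by congr pair; rewrite /= ?scale0r ?scale1r ?sub0r ?addr0.
Qed.

End OperatorRealification.

Theorem proposition3p8 (R : realType) :
  ((forall (m n : nat) (Z : 'M[R[i]]_(m, n)) (X Y : 'cV[R]_n),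
      let U := mxC X + 'i%C *: mxC Y in
      realify Z *m col_mx X Y = col_mx (mxRe (Z *m U)) (mxIm (Z *m U)))
   /\
   (forall (m n p : nat) (Z1 : 'M[R[i]]_(m, n)) (Z2 : 'M[R[i]]_(n, p)),
      realify (Z1 *m Z2) = realify Z1 *m realify Z2))
  /\
  (forall V : vectType R,
     (forall (Z : {linear cspace V -> cspace V}) (X Y : V),
        let U := spC X + 'i%C *: spC Y in
        oprealify Z (X, Y) = (spRe (Z U), spIm (Z U)))
     /\
     (forall Z1 Z2 : {linear cspace V -> cspace V},
        oprealify (Z1 \o Z2) =1 oprealify Z1 \o oprealify Z2))
  /\
  (forall (nh ne : nat) (nu dt : R)
      (curlh : 'M[R]_(ne, nh)) (curle : 'M[R]_(nh, ne)) (s : bool),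
     0 < nu ->
     let Phi := Phi_disp nu curlh curle dt s in
     let Phihat : 'M[R]_((nh + ne) + (nh + ne)) := realify Phi in
     [/\ bijective (@realvec R (nh + ne)),
         forall U : 'cV[R[i]]_(nh + ne),
           Phihat *m realvec U = realvec (Phi *m U),
         forall n : nat, Phihat ^+ n = realify (Phi ^+ n) &
         forall (U0 : 'cV[R]_(nh + ne)) (n : nat),
           Phihat ^+ n *m col_mx U0 0
             = col_mx (mxRe (Phi ^+ n *m mxC U0)) (mxIm (Phi ^+ n *m mxC U0))
           /\ usubmx (Phihat ^+ n *m col_mx U0 0) = projected_field Phi U0 n]).
Proof.
split; [split | split].
- move=> m n Z X Y U.
  have <- : realvec U = col_mx X Y by rewrite /realvec mxRe_comb mxIm_comb.
  exact: realify_realvec.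
- exact: realify_mulmx.
- move=> V; split=> [Z X Y U | Z1 Z2 w].
    by rewrite oprealifyE /U spC_decomp; case: (Z _).
  (* Each realified operator is the original one as a function, so both sides become [Z1 (Z2 w)]. *)
  by rewrite /= !oprealifyE.
- move=> nh ne nu dt curlh curle s _ Phi Phihat.
  have PhihatX k : Phihat ^+ k = realify (Phi ^+ k) by rewrite realifyX.
  split=> // [||U0 k].
  + exact: realvec_bij.
  + exact: realify_realvec.
  (* The real initial vector, padded with zero, is [realvec (mxC U0)]; so a single application of
     [realify_realvec] to the power of [Phi] serves both claims. *)
  + by rewrite PhihatX -realvec_mxC realify_realvec col_mxKu.
Qed.
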